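(* (1) Let $n\ge 3$ be an integer and let $\gamma_n:\mathbb{Z}_n\to\mathbb{R}_+$, $\gamma_{2n}:\mathbb{Z}_{2n}\to\mathbb{R}_+$ satisfy $$\begin{cases} \gamma_{n}(0)=\gamma_{2n}(0)=0,\\ \gamma_{n}(k)=\gamma_{n}(n-k), & 1\le k\le n-1,\\ \gamma_{2n}(k)=\gamma_{2n}(2n-k), & 1\le k\le 2n-1,\\ \gamma_{2n}(k)\ge \gamma_n(k), & 1\le k\le \lfloor\frac{n-1}{2}\rfloor,\\ \gamma_{2n}(n-k)-\gamma_{2n}(k)-1\ge 0, & 0\le k\le \lfloor\frac{n-1}{2}\rfloor, \end{cases}$$ and suppose that for all $x\ge 0$ and all $r_a,r_b\in[0,1]$: if $n$ is even, $$\bigl(2\gamma_{2n}(\tfrac{n}{2})-2\gamma_n(\tfrac{n}{2})-1\bigr)\bigl(r_a+r_b x^2\bigr)+\gamma_{2n}(n)(1-x)^2-(1+x^2)+2x\sqrt{(1+r_a)(1+r_b)} \ge 0,$$ and if $n$ is odd, $$\gamma_{2n}(n)(1-x)^2-(1+x^2)+2x \ge 0.$$ If $\mathrm{H}_n[\lambda]\le 2\langle\lambda,\Gamma(n)\lambda\rangle$ for all $\lambda\in\mathbb{R}_+^n$, then $\mathrm{H}_{2n}[\lambda]\le 2\langle\lambda,\Gamma(2n)\lambda\rangle$ for all $\lambda\in\mathbb{R}_+^{2n}$. (2) Let $n_0\ge 3$ be odd. If $\mathrm{H}_{n_0}[\lambda]\le 2\langle\lambda,\Psi(n_0)\lambda\rangle$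 for all $\lambda\in\mathbb{R}_+^{n_0}$, then for every integer $m\ge 1$, with $N=n_0\cdot 2^m$, one has $\mathrm{H}_{N}[\lambda]\le 2\langle\lambda,\Psi(N)\lambda\rangle$ for all $\lambda\in\mathbb{R}_+^{N}$.
   Context: $\mathbb{R}_+=[0,\infty)$ and $\mathbb{Z}_N=\{0,\dots,N-1\}$. For $\lambda\in\mathbb{R}_+^N$, indexed by $0,\dots,N-1$, $$\mathrm{H}_N[\lambda]=\frac1N\sum_{k=0}^{N-1}\lambda_k^2\log(\lambda_k^2)-\frac{\|\lambda\|_2^2}{N}\log\Big(\frac{\|\lambda\|_2^2}{N}\Big),\qquad \|\lambda\|_2^2=\sum_{k}\lambda_k^2,$$ with $0\log0=0$. $F_N$ is the $N\times N$ matrix with entries $(F_N)_{j,l}=e^{2\pi i jl/N}$, $0\le j,l\le N-1$. For a weight $\gamma_N:\mathbb{Z}_N\to\mathbb{R}_+$, set $\Gamma(N)=\frac1N F_N\,\mathrm{diag}(\gamma_N(0),\dots,\gamma_N(N-1))\,F_N^{-1}$. The word-length function is $\psi_N(k)=\min(k,N-k)$ for $0\le k\le N-1$, and $\Psi(N)=\frac1N F_N\,\mathrm{diag}(\psi_N(0),\dots,\psi_N(N-1))\,F_N^{-1}$. $\langle\cdot,\cdot\rangle$ is the standard Hermitian inner product on $\mathbb{C}^N$. The inequality $\mathrm{H}_N[\lambda]\le 2\langle\lambda,\Gamma(N)\lambda\rangle$ for all $\lambda\in\mathbb{R}_+^N$ is called the $N$--LSI (log-Sobolev inequality) for $\gamma_N$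 with constant $2$. *)

(* Defs.v *)
From HB Require Import structures.
From mathcomp Require Import all_boot all_order all_algebra.
From mathcomp Require Import complex.
From mathcomp Require Import reals exp trigo.
From mathcomp Require Import spectral.

Set Implicit Arguments.
Unset Strict Implicit.
Unset Printing Implicit Defensive.

Import Order.TTheory GRing.Theory Num.Theory.
Local Open Scope ring_scope.
Local Open Scope complex_scope.

(* A weight on Z_N is a function on nat of which only the values at
   0, ..., N - 1 matter, so that indices such as n - k need no casts. *)
Definition weight (R : realType) (N : nat) (g : nat -> R) : Prop :=
  forall k, (k < N)%N -> 0 <= g k.

Definition sqnorm (R : realType) (N : nat) (l : 'cV[R]_N) : R :=
  \sum_(k < N) l k 0 ^+ 2.

(* The convention 0 log 0 = 0 holds since ln 0 = 0 in the library. *)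
Definition entropy (R : realType) (N : nat) (l : 'cV[R]_N) : R :=
  N%:R^-1 * (\sum_(k < N) l k 0 ^+ 2 * ln (l k 0 ^+ 2))
  - sqnorm l / N%:R * ln (sqnorm l / N%:R).

Definition expi (R : realType) (t : R) : R[i] := cos t +i* sin t.

Definition Fourier (R : realType) (N : nat) : 'M[R[i]]_N :=
  \matrix_(j < N, l < N) expi (2 * pi * (j * l)%:R / N%:R).

Definition Gamma (R : realType) (N : nat) (g : nat -> R) : 'M[R[i]]_N :=
  N%:R^-1 *: (Fourier R N *m diag_mx (\row_(k < N) (g k)%:C)
              *m invmx (Fourier R N)).

(* The library's Hermitian product dotmx is stated for row vectors. *)
Definition inner (R : realType) (N : nat) (u v : 'cV[R[i]]_N) : R[i] :=
  dotmx u^T v^T.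

(* The inequality is stated in R[i], whose order relates x and y only when
   they have the same imaginary part; both sides are real here, because
   Gamma N g is Hermitian for every real g. *)
Definition log_sobolev (R : realType) (N : nat) (g : nat -> R) : Prop :=
  forall l : 'cV[R]_N, (forall k, 0 <= l k 0) ->
    let lC := map_mx (real_complex R) l in
    (entropy l)%:C <= 2 * inner lC (Gamma N g *m lC).

Definition word_length (R : realType) (N : nat) (k : nat) : R :=
  (minn k (N - k))%:R.

(* Main.v *)
Require Import Defs.
From mathcomp Require Import all_boot all_order all_algebra.
From mathcomp Require Import reals.
From mathcomp Require Import complex spectral.
From mathcomp Require Import normedtype derive realfun exp trigo.
From mathcomp Require Import ring lra zify.

(** Write a nonnegative function [f] on [Z_(2n)] as its even part [fe] and its
    odd part [fo], both functions on [Z_n], with mean squares [a] and [b].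

    The entropy obeys the chain rule ([ent_split]): that of [f] is the average of
    the entropies of [fe] and [fo] plus the entropy of the two-point function
    [(sqrt a, sqrt b)].  The first part is controlled by the inequality on [Z_n],
    and the second is at most [hellinger a b / 2], where
    [hellinger a b = (sqrt a - sqrt b) ^ 2]; this is the sharp log-Sobolev
    inequality on two points ([two_point_lsi]).

    On the energy side the discrete Fourier transform diagonalises
    [Gamma N g], so that the quadratic form is a weighted sum of the power
    spectrum ([inner_Gamma]).  With [z = dft n fe k] and [w] the twisted
    [dft n fo k], the transform of [f] is [z + w] at frequency [k] and [z - w] at
    frequency [n + k].  Since the two weights of such a pair differ by at least
    1, the parallelogram law gives the energies of [fe] and [fo] at frequency [k]
    plus a surplus of at least [hellinger (|z| ^ 2) (|w| ^ 2)]
    ([weighted_pair]).  By Parseval [a] and [b] are sums of powers over all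
    frequencies, and [hellinger] is subadditive ([hellinger_sum]), so these
    surpluses pay for the two-point entropy ([spectral_doubling]).  The pair at
    frequency [n / 2], for even [n], has two equal weights and yields no surplus
    of this kind; it is treated together with frequency 0, and this is what the
    inequality in [x], [ra], [rb] is for ([real_modes_bound]): [x ^ 2] is the
    ratio of the powers of [fo] and [fe] at frequency 0, while [ra] and [rb] are
    the powers at [n / 2] relative to those at 0, which are at most 1 by
    nonnegativity.

    For word lengths the doubling step applies from odd [n] to [2n], but the
    inequality in [x], [ra], [rb] fails for the pair of word lengths on [Z_n] and
    [Z_(2n)] when [n] is even (take [x = 1], [ra = 0], [rb = 1]).  There is room,
    though: the step from odd [n] does not need the full weight [n] at the middle
    frequency of [Z_(2n)].  So the induction runs with the smaller weight
    [dented_length], which is the word length diminished by 1/2 at the middle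
    frequency; this half restores the inequality at every later step, and the
    result passes to the word length because the energy increases with the
    weight. *)

Import Order.TTheory GRing.Theory Num.Theory.
Import numFieldNormedType.Exports.
Set Implicit Arguments.
Unset Strict Implicit.
Local Open Scope ring_scope.
Local Open Scope complex_scope.

(** * Two-point log-Sobolev inequality *)

Definition xlnx (R : realType) (x : R) : R := x * ln x.

(** The squared distance between the amplitudes of two powers [a] and [b]; sums
    of such terms are squared Hellinger distances, and the subadditivity below is
    the reverse triangle inequality for Euclidean norms. *)
Definition hellinger (R : realType) (a b : R) : R :=
  (Num.sqrt a - Num.sqrt b) ^+ 2.

Lemma ge0_derive_ge (R : realType) (f df : R -> R) (a y : R) :
  (forall x, a <= x -> is_derive x 1 f (df x)) ->
  (forall x, a <= x -> 0 <= df x) -> a <= y -> f a <= f y.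
Proof.
move=> dfx df0; rewrite le_eqVlt => /predU1P[-> //|ay].
have [||c cay fE] := @MVT R f df a y ay.
  by move=> x; rewrite in_itv/= => /andP[/ltW ax _]; exact: dfx.
  apply: derivable_within_continuous => x; rewrite in_itv/= => /andP[ax _].
  by have [] := dfx _ ax.
rewrite -subr_ge0 fE mulr_ge0 ?subr_ge0 ?(ltW ay)// df0//.
by move: cay; rewrite in_itv/= => /andP[/ltW].
Qed.

Lemma is_derive_ln_half (R : realType) (x : R) : 0 < x ->
  is_derive x 1 (fun y : R => ln ((y ^+ 2 + 1) / 2)) (2 * x / (x ^+ 2 + 1)).
Proof.
move=> x0.
have p : 0 < (x ^+ 2 + 1) / 2 by nra.
have d1 := is_derive1_ln p.
have d2 : is_derive x 1 (fun y : R => (y ^+ 2 + 1) / 2) x.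
  by apply: is_derive_eq; rewrite /GRing.scale/=; field.
have := @is_derive1_comp R (@ln R) (fun y : R => (y ^+ 2 + 1) / 2) x _ _ d1 d2.
move=> H; apply: (is_derive_eq (f' := _ * x)).
by field; nra.
Qed.

(** Both sides agree at 1, and the derivative of their difference is
    [(y - 1) ^ 2 / (y ^ 2 * (y ^ 2 + 1))].  Up to the factor [2 * y], that
    difference is the derivative of the function in [two_point_ratio]. *)
Lemma two_point_aux (R : realType) (y : R) : 1 <= y ->
  2 * ln y <= 1 - y^-1 + ln ((y ^+ 2 + 1) / 2).
Proof.
move=> y1; rewrite -subr_ge0.
pose f (y : R) := 1 - y^-1 + ln ((y ^+ 2 + 1) / 2) - 2 * ln y.
pose df (x : R) := x ^- 2 + 2 * x / (x ^+ 2 + 1) - 2 / x.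
have f1 : f 1 = 0.
  rewrite /f invr1 subrr ln1 expr1n (_ : (1 + 1) / 2 = 1 :> R); last by field.
  by rewrite ln1; ring.
suff : f 1 <= f y by rewrite f1.
apply: (@ge0_derive_ge _ f df 1 y _ _ y1) => x x1; have x0 : 0 < x by lra.
  have d1 := is_derive1_ln x0.
  have d2 := is_derive_ln_half x0.
  have d3 := @is_deriveV R id x 1 1 (lt0r_neq0 x0) _.
  apply: is_derive_eq; rewrite /df /GRing.scale/=; field.
  by rewrite lt0r_neq0//=; nra.
rewrite (_ : df x = (x - 1) ^+ 2 / (x ^+ 2 * (x ^+ 2 + 1))).
  by rewrite divr_ge0 ?sqr_ge0// mulr_ge0 ?sqr_ge0// addr_ge0 ?sqr_ge0.
rewrite /df; field.
by rewrite lt0r_neq0//=; nra.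
Qed.

(** The two-point inequality in the scale-free variable [y = s / t], for values
    [s >= t > 0]. *)
Lemma two_point_ratio (R : realType) (y : R) : 1 <= y ->
  0 <= (y - 1) ^+ 2 - 2 * y ^+ 2 * ln y + (y ^+ 2 + 1) * ln ((y ^+ 2 + 1) / 2).
Proof.
pose f (y : R) :=
  (y - 1) ^+ 2 - 2 * y ^+ 2 * ln y + (y ^+ 2 + 1) * ln ((y ^+ 2 + 1) / 2).
pose df (x : R) := 2 * x * (1 - x^-1 + ln ((x ^+ 2 + 1) / 2) - 2 * ln x).
have f1 : f 1 = 0.
  rewrite /f expr1n (_ : (1 + 1) / 2 = 1 :> R); last by field.
  by rewrite ln1; ring.
move=> y1; suff : f 1 <= f y by rewrite f1.
apply: (@ge0_derive_ge _ f df 1 y _ _ y1) => x x1; have x0 : 0 < x by lra.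
  have d1 := is_derive1_ln x0.
  have d2 := is_derive_ln_half x0.
  apply: is_derive_eq; rewrite /df /GRing.scale/=; field.
  by rewrite lt0r_neq0//=; nra.
by rewrite mulr_ge0 ?subr_ge0 ?two_point_aux//; lra.
Qed.

(** By symmetry [b <= a].  For [b > 0] this is [two_point_ratio] at
    [y = sqrt (a / b)], multiplied by [b / 2]; for [b = 0] it is [ln 2 <= 1]. *)
Lemma two_point_lsi (R : realType) (a b : R) : 0 <= a -> 0 <= b ->
  (xlnx a + xlnx b) / 2 - xlnx ((a + b) / 2) <= hellinger a b / 2.
Proof.
wlog ab : a b / b <= a.
  move=> H a0 b0; have [ba|/ltW ab] := leP b a; first exact: H.
  have := H b a ab b0 a0.
  by rewrite (addrC (xlnx b)) (addrC b) /hellinger -sqrrN opprB.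
move=> a0; rewrite le_eqVlt => /predU1P[<-|b0].
  rewrite /xlnx /hellinger mul0r sqrtr0 !subr0 !addr0 sqr_sqrtr//.
  move: a0; rewrite le_eqVlt => /predU1P[<-|a0]; first by rewrite !mul0r subrr.
  have l2 : ln (2 : R) <= 1.
    by have := @le_ln1Dx R 1 _; rewrite (_ : 1 + 1 = 2)//; apply; lra.
  rewrite ln_div// ?posrE//.
  have -> : a * ln a / 2 - a / 2 * (ln a - ln 2) = a / 2 * ln 2 by field.
  by rewrite ler_piMr// divr_ge0// ltW.
set t := Num.sqrt b; set s := Num.sqrt a.
have t0 : 0 < t by rewrite sqrtr_gt0.
have s0 : 0 < s by rewrite sqrtr_gt0; exact: lt_le_trans ab.
have aE : a = s ^+ 2 by rewrite sqr_sqrtr.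
have bE : b = t ^+ 2 by rewrite sqr_sqrtr// ltW.
have ts : 1 <= s / t by rewrite ler_pdivlMr// mul1r ler_sqrt.
have := two_point_ratio ts.
rewrite /hellinger -/s -/t /xlnx aE bE.
have -> : (s ^+ 2 + t ^+ 2) / 2 = t ^+ 2 * (((s / t) ^+ 2 + 1) / 2).
  by field; rewrite lt0r_neq0.
set L := (_ / 2); have L0 : 0 < L.
  by rewrite /L divr_gt0// ltr_wpDl// sqr_ge0.
rewrite ln_div ?posrE// [ln (t ^+ 2 * L)]lnM ?posrE ?exprn_gt0// !lnXn//.
have -> : (s / t) ^+ 2 + 1 = 2 * L by rewrite /L; field; rewrite lt0r_neq0.
have LE : t ^+ 2 * L = (s ^+ 2 + t ^+ 2) / 2.
  by rewrite /L; field; rewrite lt0r_neq0.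
rewrite -(pmulr_rge0 _ (exprn_gt0 2 t0)) => H.
rewrite LE -subr_ge0 -(pmulr_rge0 _ (ltr0n R 2)).
apply: le_trans H _; rewrite le_eqVlt; apply/orP; left; apply/eqP.
transitivity (t ^+ 2 * (s / t - 1) ^+ 2
  - 2 * (t ^+ 2 * (s / t) ^+ 2) * (ln s - ln t) + 2 * (t ^+ 2 * L) * ln L).
  by ring.
rewrite LE; field; rewrite lt0r_neq0//.
Qed.

(** Expanded, this is the Cauchy-Schwarz inequality for the vectors
    [(sqrt a, sqrt c)] and [(sqrt b, sqrt d)]. *)
Lemma hellinger_add (R : realType) (a b c d : R) :
  0 <= a -> 0 <= b -> 0 <= c -> 0 <= d ->
  hellinger (a + c) (b + d) <= hellinger a b + hellinger c d.
Proof.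
move=> a0 b0 c0 d0; rewrite /hellinger !sqrrB !sqr_sqrtr ?addr_ge0//.
suff : Num.sqrt a * Num.sqrt b + Num.sqrt c * Num.sqrt d <=
       Num.sqrt (a + c) * Num.sqrt (b + d) by lra.
rewrite -!sqrtrM ?addr_ge0//.
rewrite -(@ler_pXn2r _ 2) ?nnegrE ?addr_ge0 ?sqrtr_ge0//.
rewrite sqr_sqrtr ?mulr_ge0 ?addr_ge0// sqrrD !sqr_sqrtr ?mulr_ge0//.
have : 0 <= (Num.sqrt (a * d) - Num.sqrt (b * c)) ^+ 2 by exact: sqr_ge0.
rewrite sqrrB !sqr_sqrtr ?mulr_ge0// -!sqrtrM ?mulr_ge0//.
rewrite (_ : a * d * (b * c) = a * b * (c * d)); last by ring.
by lra.
Qed.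

Lemma hellinger_sum (R : realType) (I : Type) (r : seq I) (P : pred I)
    (a b : I -> R) :
  (forall i, P i -> 0 <= a i) -> (forall i, P i -> 0 <= b i) ->
  hellinger (\sum_(i <- r | P i) a i) (\sum_(i <- r | P i) b i)
    <= \sum_(i <- r | P i) hellinger (a i) (b i).
Proof.
move=> a0 b0; elim: r => [|i r IH].
  by rewrite !big_nil /hellinger subrr expr0n.
rewrite !big_cons; case: ifPn => // Pi.
apply: le_trans (hellinger_add _ _ _ _) _; rewrite ?a0 ?b0 ?sumr_ge0//.
by rewrite lerD2l.
Qed.

Lemma hellingerZ (R : realType) (t a b : R) : 0 <= t ->
  hellinger (t * a) (t * b) = t * hellinger a b.
Proof.
by move=> t0; rewrite /hellinger !sqrtrM// -mulrBr exprMn sqr_sqrtr.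
Qed.

(** * Complex exponentials and the discrete Fourier transform *)

Definition sqmod (R : realType) (z : R[i]) : R :=
  complex.Re z ^+ 2 + complex.Im z ^+ 2.

Lemma sqmodE (R : realType) (z : R[i]) : (sqmod z)%:C = `|z| ^+ 2.
Proof. exact: add_Re2_Im2. Qed.

Lemma sqmod_ge0 (R : realType) (z : R[i]) : 0 <= sqmod z.
Proof. by rewrite addr_ge0 ?sqr_ge0. Qed.

Lemma parallelogram (R : realType) (z w : R[i]) :
  sqmod (z + w) + sqmod (z - w) = 2 * (sqmod z + sqmod w).
Proof. by case: z w => [a b] [c d]; rewrite /sqmod/=; ring. Qed.

Lemma sqmodM (R : realType) (z w : R[i]) : sqmod (z * w) = sqmod z * sqmod w.
Proof. by case: z w => [a b] [c d]; rewrite /sqmod/=; ring. Qed.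

Lemma sqmodN (R : realType) (z : R[i]) : sqmod (- z) = sqmod z.
Proof. by case: z => a b; rewrite /sqmod/= !sqrrN. Qed.

Lemma hellinger_sqmod (R : realType) (z w : R[i]) :
  hellinger (sqmod z) (sqmod w) <= sqmod (z - w).
Proof.
rewrite /hellinger sqrrB !sqr_sqrtr ?sqmod_ge0// -sqrtrM ?sqmod_ge0//.
case: z w => [a b] [c d]; rewrite /sqmod/=.
have : a * c + b * d <= Num.sqrt ((a ^+ 2 + b ^+ 2) * (c ^+ 2 + d ^+ 2)).
  apply: le_trans (ler_norm _) _; rewrite -sqrtr_sqr ler_wsqrtr//.
  have := sqr_ge0 (a * d - b * c); lra.
by rewrite mulr2n; lra.
Qed.

(** Replacing the weights by [c] and [c + 1] leaves, after the parallelogram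
    law, a surplus of [sqmod (z - w)]. *)
Lemma weighted_pair (R : realType) (c x y : R) (z w : R[i]) :
  c <= x -> x + 1 <= y ->
  2 * c * (sqmod z + sqmod w) + hellinger (sqmod z) (sqmod w)
    <= x * sqmod (z + w) + y * sqmod (z - w).
Proof.
move=> cx xy; have := parallelogram z w; have := hellinger_sqmod z w.
have := sqmod_ge0 z; have := sqmod_ge0 w; have := sqmod_ge0 (z - w).
move: (sqmod (z - w)) (sqmod (z + w)) (sqmod z) (sqmod w) => d s a b d0 b0 a0.
move=> h /(canRL (addrK _)) ->; nra.
Qed.

Lemma expiD (R : realType) (s t : R) : expi (s + t) = expi s * expi t.
Proof. by rewrite /expi cosD sinD; simpc; congr (_ +i* _); ring. Qed.

Lemma expi0 (R : realType) : expi 0 = 1 :> R[i].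
Proof. by rewrite /expi cos0 sin0. Qed.

Lemma expi_pi (R : realType) : expi pi = - 1 :> R[i].
Proof. by rewrite /expi cospi sinpi; simpc. Qed.

Lemma expi_2pi (R : realType) : expi (2 * pi) = 1 :> R[i].
Proof. by rewrite mulrC mulr_natr mulr2n expiD expi_pi mulrNN mulr1. Qed.

Lemma sqmod_expi (R : realType) (t : R) : sqmod (expi t) = 1.
Proof. exact: cos2Dsin2. Qed.

Lemma expi_conj (R : realType) (t : R) : Num.conj (expi t) = expi (- t).
Proof.
by rewrite /expi cosN sinN.
Qed.

Lemma expiMn (R : realType) (t : R) n : expi (t *+ n) = expi t ^+ n.
Proof. by elim: n => [|n IH]; rewrite ?mulr0n ?expi0// mulrS expiD IH exprS. Qed.

(** The half angle lies strictly between 0 and [pi], where the sine is positive,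
    and [cos t = 1 - 2 * sin (t / 2) ^ 2]. *)
Lemma expi_neq1 (R : realType) (t : R) : 0 < t < 2 * pi -> expi t != 1.
Proof.
move=> /andP[t0 t2]; apply/eqP => -[ct _].
have : 0 < sin (t / 2) by apply: sin_gt0_pi; lra.
have := cos2Dsin2 (t / 2).
have : cos (t / 2 + t / 2) = 1 by rewrite -splitr.
rewrite cosD; nra.
Qed.

Lemma sum_root1 (F : fieldType) (N : nat) (z : F) :
  z ^+ N = 1 -> z != 1 -> \sum_(k < N) z ^+ k = 0.
Proof.
move=> zN z1; apply/eqP; have /eqP := subrX1 z N.
by rewrite zN subrr eq_sym mulf_eq0 subr_eq0 (negPf z1).
Qed.

(** Each off-diagonal entry is a geometric sum whose ratio is an [N]-th root of
    unity other than 1. *)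
Lemma Fourier_adj (R : realType) (N : nat) :
  Fourier R N *m (map_mx Num.conj (Fourier R N))^T = (N%:R)%:M.
Proof.
apply/matrixP => j l; rewrite !mxE.
have Nj : (0 < N)%N by case: N j {l} => [[]|].
have N0 : N%:R != 0 :> R by rewrite pnatr_eq0 -lt0n.
pose z := expi (2 * pi / N%:R * (j%:R - l%:R) : R).
under eq_bigr => k _.
  rewrite !mxE expi_conj -expiD (_ : _ + _ = (2 * pi / N%:R * (j%:R - l%:R)) *+ k).
    by rewrite expiMn -/z; over.
  by rewrite -mulr_natr !natrM; field.
have [jl|jl] := eqVneq j l.
  rewrite mulr1n /z jl subrr mulr0 expi0.
  by under eq_bigr do rewrite expr1n; rewrite sumr_const card_ord.
rewrite mulr0n sum_root1//.
  rewrite /z -expiMn (_ : _ *+ N = 2 * pi *+ j - 2 * pi *+ l).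
    by rewrite expiD -expi_conj !expiMn expi_2pi !expr1n rmorph1 mulr1.
  by rewrite -mulr_natr -(mulr_natr (2 * pi) j) -(mulr_natr (2 * pi) l); field.
have pos (m k : nat) : (m < N)%N -> (k < m)%N ->
    expi (2 * pi / N%:R * (m%:R - k%:R) : R) != 1.
  move=> mN km; apply: expi_neq1.
  have p0 := pi_gt0 R.
  have d0 : (0 : R) < m%:R - k%:R by rewrite subr_gt0 ltr_nat.
  have dN : (m%:R - k%:R : R) < N%:R.
    by rewrite ltrBlDr -natrD ltr_nat ltn_addr.
  have N00 : (0 : R) < N%:R by rewrite ltr0n.
  rewrite mulr_gt0//=; last by rewrite divr_gt0// mulr_gt0.
  by rewrite mulrAC ltr_pdivrMr// ltr_pM2l// mulr_gt0.
have [lj|jl'|/val_inj/eqP] := ltngtP l j; last by rewrite eq_sym (negPf jl).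
  exact: pos.
have := pos _ _ (ltn_ord l) jl'.
apply: contraNneq => z1; rewrite -opprB mulrN -expi_conj -/z z1.
by rewrite rmorph1.
Qed.

Lemma Fourier_inv (R : realType) (N : nat) : (0 < N)%N ->
  invmx (Fourier R N) = N%:R^-1 *: (map_mx Num.conj (Fourier R N))^T.
Proof.
move=> N0; set B := _ *: _.
have AB : Fourier R N *m B = 1%:M.
  rewrite /B -scalemxAr Fourier_adj scale_scalar_mx mulVf// pnatr_eq0 -lt0n//.
by rewrite -[RHS](mulKmx (proj1 (mulmx1_unit AB))) AB mulmx1.
Qed.

Definition dft (R : realType) (N : nat) (f : nat -> R) (k : nat) : R[i] :=
  \sum_(j < N) (f j)%:C * expi (2 * pi * (j * k)%:R / N%:R).

Definition spectrum (R : realType) (N : nat) (f : nat -> R) (k : nat) : R :=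
  sqmod (dft N f k).

Lemma spectrum_ge0 (R : realType) (n : nat) (f : nat -> R) (k : nat) :
  0 <= spectrum n f k.
Proof. exact: sqmod_ge0. Qed.

(** The Fourier matrix is symmetric, so for a real vector [l] the conjugate of
    [Gamma N g *m l] is [N^-2] times [conj F *m D *m F *m l], and the quadratic
    form becomes the diagonal form [D] on [F *m l].  This removes complex numbers
    from the log-Sobolev inequality. *)
Lemma inner_Gamma (R : realType) (N : nat) (g : nat -> R) (f : nat -> R) :
  let l := map_mx (real_complex R) (\col_(k < N) f k) in (0 < N)%N ->
  inner l (Gamma N g *m l) =
    ((\sum_(k < N) g k * spectrum N f k) / N%:R ^+ 2)%:C.
Proof.
move=> l N0; pose w := Fourier R N *m l.
have Fsym : (Fourier R N)^T = Fourier R N.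
  by apply/matrixP => i j; rewrite !mxE mulnC.
have wE k : w k 0 = dft N f k.
  by rewrite mxE; apply: eq_bigr => j _; rewrite !mxE mulrC mulnC.
have Dconj : map_mx Num.conj (diag_mx (\row_(k < N) (g k)%:C))
    = diag_mx (\row_(k < N) (g k)%:C).
  rewrite map_diag_mx; congr diag_mx; apply/matrixP => i j.
  by rewrite !mxE; apply: conj_Creal; rewrite complex_real.
have lconj : map_mx Num.conj l = l.
  by apply/matrixP => i j; rewrite !mxE conj_Creal// complex_real.
have Nconj : (N%:R^-1 : R[i])^* = N%:R^-1 by rewrite fmorphV rmorph_nat.
set D := diag_mx _ in Dconj.
have -> : inner l (Gamma N g *m l) =
    N%:R^-1 ^+ 2 * ((map_mx Num.conj w)^T *m D *m w) 0 0.
  rewrite /inner dotmxE trmxK /Gamma Fourier_inv// map_trmx Fsym.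
  rewrite -!scalemxAr -!scalemxAl !map_mxZ !map_mxM.
  rewrite [map_mx _ (map_mx _ _)]map_mxCK [map_mx _ (diag_mx _)]Dconj.
  rewrite [map_mx _ l]lconj [X in X *: (X *: _)]Nconj trmx_mul.
  rewrite [(map_mx _ (Fourier R N))^T]map_trmx Fsym scalerA -scalemxAr mxE.
  by rewrite -expr2 /w !mulmxA.
rewrite -mulmxA mxE [in RHS]rmorphM/= fmorphV rmorphXn/= rmorph_nat.
rewrite mulrC exprVn; congr (_ * _); rewrite rmorph_sum/=.
apply: eq_bigr => k _; rewrite mul_diag_mx mxE [map_mx _ _ _ _]mxE.
rewrite [X in _ * X]mxE wE rmorphM/= sqmodE normCK mxE; ring.
Qed.

(** The case of the constant weight 1, for which [Gamma] is scalar. *)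
Lemma parseval (R : realType) (N : nat) (f : nat -> R) : (0 < N)%N ->
  (\sum_(k < N) spectrum N f k) / N%:R ^+ 2 = (\sum_(k < N) f k ^+ 2) / N%:R.
Proof.
move=> N0; have := inner_Gamma (fun=> 1) f N0.
have N0' : N%:R != 0 :> R[i] by rewrite pnatr_eq0 -lt0n.
have FU : Fourier R N \in unitmx.
  apply: (proj1 (mulmx1_unit (B := invmx (Fourier R N)) _)).
  by rewrite Fourier_inv// -scalemxAr Fourier_adj scale_scalar_mx mulVf.
rewrite /Gamma (_ : diag_mx _ = 1%:M); last first.
  by apply/matrixP => i j; rewrite !mxE.
rewrite mulmx1 mulmxV// -scalemxAl mul1mx /inner dotmxE trmxK map_mxZ/=.
rewrite -scalemxAr.
rewrite mxE [in X in X -> _]mxE => H; apply: complexI.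
under eq_bigr do rewrite -[spectrum _ _ _]mul1r.
rewrite -{}H mulrC rmorphM/= fmorphV rmorph_nat fmorphV/= rmorph_nat.
congr (_ * _); rewrite rmorph_sum/=; apply: eq_bigr => k _; rewrite !mxE.
by rewrite [X in _ * X]conj_Creal ?complex_real// rmorphXn.
Qed.

(** The entropy of a vector given by a function on [nat], so that restricting to
    even or odd indices needs no casts. *)
Definition ent (R : realType) (N : nat) (f : nat -> R) : R :=
  N%:R^-1 * (\sum_(k < N) xlnx (f k ^+ 2))
  - xlnx ((\sum_(k < N) f k ^+ 2) / N%:R).

Lemma log_sobolevP (R : realType) (N : nat) (g : nat -> R) : (0 < N)%N ->
  log_sobolev N g <->
  (forall f : nat -> R, (forall k, (k < N)%N -> 0 <= f k) ->
    ent N f <= 2 * ((\sum_(k < N) g k * spectrum N f k) / N%:R ^+ 2)).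
Proof.
move=> N0.
have entE (f : nat -> R) : entropy (\col_(k < N) f k) = ent N f.
  rewrite /entropy /ent /sqnorm /xlnx.
  by under eq_bigr do rewrite mxE; under [in X in _ - X]eq_bigr do rewrite mxE.
have rhs (f : nat -> R) :
    ((ent N f)%:C <= 2 * inner (map_mx (real_complex R) (\col_(k < N) f k))
      (Gamma N g *m map_mx (real_complex R) (\col_(k < N) f k))) =
    (ent N f <= 2 * ((\sum_(k < N) g k * spectrum N f k) / N%:R ^+ 2)).
  by rewrite inner_Gamma// -[in LHS](rmorph_nat (real_complex R) 2) -rmorphM lecR.
split=> [H f f0|H l l0].
  by rewrite -rhs -entE; apply: H => k; rewrite mxE f0.
pose f m := if insub m is Some i then l i 0 else 0.
have -> : l = \col_(k < N) f k.
  by apply/matrixP => i j; rewrite !mxE /f valK ord1.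
rewrite entE; move: (H f); rewrite -rhs; apply=> k kN.
by rewrite /f insubT.
Qed.

Lemma sum_double (V : nmodType) (n : nat) (F : nat -> V) :
  \sum_(k < 2 * n) F k = \sum_(k < n) (F (2 * k)%N + F (2 * k).+1).
Proof.
elim: n => [|n IH]; first by rewrite !big_ord0.
by rewrite mulnS !addSn add0n !big_ord_recr/= IH addrA.
Qed.

Lemma sum_halves (V : nmodType) (n : nat) (F : nat -> V) :
  \sum_(k < 2 * n) F k = \sum_(k < n) (F k + F (n + k)%N).
Proof. by rewrite mul2n -addnn big_split_ord/= big_split. Qed.

Lemma expi_periodic (R : realType) (t : R) (m : nat) :
  expi (t + 2 * pi *+ m) = expi t.
Proof. by rewrite expiD expiMn expi_2pi expr1n mulr1. Qed.

Lemma dft_periodic (R : realType) (n : nat) (f : nat -> R) (k : nat) :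
  (0 < n)%N -> dft n f (n + k) = dft n f k.
Proof.
move=> n0; apply: eq_bigr => j _; congr (_ * _).
rewrite -[RHS](expi_periodic _ j); congr expi.
rewrite mulnDr natrD -(mulr_natr (2 * pi) j) natrM; field.
by rewrite pnatr_eq0 -lt0n.
Qed.

(** * Splitting a function on [Z_(2n)] into its even and odd parts *)

Definition evens (T : Type) (f : nat -> T) (j : nat) : T := f (2 * j)%N.

Definition odds (T : Type) (f : nat -> T) (j : nat) : T := f (2 * j).+1.

Lemma dft_split (R : realType) (n : nat) (f : nat -> R) (k : nat) : (0 < n)%N ->
  dft (2 * n) f k = dft n (evens f) k
    + expi (pi * k%:R / n%:R) * dft n (odds f) k.
Proof.
move=> n0; have n0' : n%:R != 0 :> R by rewrite pnatr_eq0 -lt0n.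
have := sum_double n
  (fun j => (f j)%:C * expi (2 * pi * (j * k)%:R / (2 * n)%:R)).
rewrite /dft => ->; rewrite big_split mulr_sumr/=.
congr (_ + _); apply: eq_bigr => j _.
  by congr (_ * expi _); rewrite !natrM; field.
rewrite mulrCA -expiD; congr (_ * expi _); rewrite mulSn natrD !natrM; field.
exact: n0'.
Qed.

(** Both transforms on [Z_n] are [n]-periodic, while the twist changes sign,
    because [expi pi = - 1]. *)
Lemma dft_split_half (R : realType) (n : nat) (f : nat -> R) (k : nat) :
  (0 < n)%N ->
  dft (2 * n) f (n + k) = dft n (evens f) k
    - expi (pi * k%:R / n%:R) * dft n (odds f) k.
Proof.
move=> n0; rewrite dft_split// !dft_periodic// natrD.
rewrite (_ : pi * _ / _ = pi + pi * k%:R / n%:R); last first.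
  by field; rewrite pnatr_eq0 -lt0n.
by rewrite expiD expi_pi !mulN1r mulNr.
Qed.

(** At frequency 0 the terms of the transform of a nonnegative function all have
    argument 0, so the triangle inequality is an equality there. *)
Lemma spectrum_le0 (R : realType) (n : nat) (f : nat -> R) (k : nat) :
  (forall j, (j < n)%N -> 0 <= f j) -> spectrum n f k <= spectrum n f 0.
Proof.
move=> f0; have d0 : dft n f 0 = (\sum_(j < n) f j)%:C.
  rewrite rmorph_sum/=; apply: eq_bigr => j _.
  by rewrite muln0 mulr0 mul0r expi0 mulr1.
rewrite -lecR !sqmodE ler_pXn2r ?nnegrE// d0.
have s0 : 0 <= \sum_(j < n) f j by apply: sumr_ge0 => j _; exact: f0.
rewrite [X in _ <= X]ger0_norm ?ler0c//.
apply: le_trans (ler_norm_sum _ _ _) _; rewrite rmorph_sum/=.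
apply: ler_sum => j _; rewrite normrM (_ : `|expi _| = 1) ?mulr1.
  by rewrite ger0_norm// ler0c f0.
by rewrite normc_def/= cos2Dsin2 sqrtr1.
Qed.

Lemma ent_split (R : realType) (n : nat) (f : nat -> R) : (0 < n)%N ->
  let fe := evens f in let fo := odds f in
  let a := (\sum_(k < n) fe k ^+ 2) / n%:R in
  let b := (\sum_(k < n) fo k ^+ 2) / n%:R in
  ent (2 * n) f =
    (ent n fe + ent n fo) / 2 + ((xlnx a + xlnx b) / 2 - xlnx ((a + b) / 2)).
Proof.
move=> n0 fe fo a b; have n0' : n%:R != 0 :> R by rewrite pnatr_eq0 -lt0n.
rewrite /ent (sum_double n (fun k => xlnx (f k ^+ 2))).
rewrite (sum_double n (fun k => f k ^+ 2)) !big_split/=.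
rewrite -/a -/b (_ : (_ + _) / (2 * n)%:R = (a + b) / 2); last first.
  by rewrite /a /b natrM; field.
by rewrite natrM; field.
Qed.

(** * Frequencies 0 and n / 2 *)

(** The inequality in [x] multiplied by [p ^ 2], at [x = q / p].  The form is
    symmetric under exchanging [(p, ra)] and [(q, rb)], so for [p = 0] the value
    [x = 0] with exchanged roles gives it. *)
Lemma real_modes_homog (R : realType) (G D p q ra rb : R) :
  (forall x ra rb : R, 0 <= x -> 0 <= ra <= 1 -> 0 <= rb <= 1 ->
    0 <= (2 * D - 1) * (ra + rb * x ^+ 2) + G * (1 - x) ^+ 2 - (1 + x ^+ 2)
         + 2 * x * Num.sqrt ((1 + ra) * (1 + rb))) ->
  0 <= p -> 0 <= q -> 0 <= ra <= 1 -> 0 <= rb <= 1 ->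
  0 <= (2 * D - 1) * (ra * p ^+ 2 + rb * q ^+ 2) + G * (p - q) ^+ 2
       - (p ^+ 2 + q ^+ 2) + 2 * p * q * Num.sqrt ((1 + ra) * (1 + rb)).
Proof.
move=> H; rewrite le_eqVlt => /predU1P[<- q0 _ rb1|p0 q0 ra1 rb1].
  (* Exchanged roles: [rb] in the place of [ra]. *)
  have z01 : 0 <= (0 : R) <= 1 by rewrite lexx ler01.
  have := mulr_ge0 (sqr_ge0 q) (H 0 rb 0 (lexx _) rb1 z01).
  move: (Num.sqrt _) (Num.sqrt _) => s t; nra.
have x0 : 0 <= q / p by rewrite divr_ge0// ltW.
have := mulr_ge0 (sqr_ge0 p) (H _ _ _ x0 ra1 rb1).
congr (_ <= _); field; exact: lt0r_neq0.
Qed.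

Lemma ratio_exists (R : realType) (u a : R) : 0 <= u <= a ->
  exists2 r : R, 0 <= r <= 1 & u = r * a.
Proof.
move=> /andP[u0]; have [<- ua|a0] := eqVneq 0 a.
  by exists 0; rewrite ?lexx ?ler01// mul0r; apply/le_anti; rewrite u0 ua.
move=> ua; have a1 : 0 < a by rewrite lt_neqAle a0 (le_trans u0).
exists (u / a); rewrite ?divfK ?lt0r_neq0//.
by rewrite divr_ge0 ?(ltW a1)// ler_pdivrMr// mul1r.
Qed.

(** Here [a], [b] are the powers of the even and odd parts at frequency 0 and
    [u], [v] those at frequency [n / 2]; [G] is the weight at [n], and [D] is the
    gain in weight at [n / 2]. *)
Lemma real_modes_bound (R : realType) (G D a b u v : R) :
  (forall x ra rb : R, 0 <= x -> 0 <= ra <= 1 -> 0 <= rb <= 1 ->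
    0 <= (2 * D - 1) * (ra + rb * x ^+ 2) + G * (1 - x) ^+ 2 - (1 + x ^+ 2)
         + 2 * x * Num.sqrt ((1 + ra) * (1 + rb))) ->
  0 <= u <= a -> 0 <= v <= b ->
  hellinger (a + u) (b + v) <= G * hellinger a b + 2 * D * (u + v).
Proof.
move=> H ua vb.
have a0 : 0 <= a by have /andP[u0] := ua; exact: le_trans.
have b0 : 0 <= b by have /andP[v0] := vb; exact: le_trans.
have [ra /[dup] ra1 /andP[ra0 _] ->] := ratio_exists ua.
have [rb /[dup] rb1 /andP[rb0 _] ->] := ratio_exists vb.
have := real_modes_homog H (sqrtr_ge0 a) (sqrtr_ge0 b) ra1 rb1.
rewrite /hellinger (_ : a + ra * a = (1 + ra) * a); last by ring.
rewrite (_ : b + rb * b = (1 + rb) * b); last by ring.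
have ra1' : 0 <= 1 + ra by lra.
have rb1' : 0 <= 1 + rb by lra.
rewrite !sqrtrM//.
have := sqr_sqrtr a0; have := sqr_sqrtr b0.
have := sqr_sqrtr ra1'; have := sqr_sqrtr rb1'.
set s := Num.sqrt a; set t := Num.sqrt b.
set sa := Num.sqrt (1 + ra); set sb := Num.sqrt (1 + rb).
move=> sbE saE tE sE; rewrite sE tE => K.
have -> : (sa * s - sb * t) ^+ 2 =
    sa ^+ 2 * s ^+ 2 - 2 * s * t * (sa * sb) + sb ^+ 2 * t ^+ 2 by ring.
by rewrite saE sbE sE tE; lra.
Qed.

(** * Doubling the cycle *)

(** The energy of [f] dominates the energies of its two parts plus what the
    two-point entropy costs.  Frequencies are grouped into pairs [k], [n + k];
    the symmetry of the weights turns the weight at [n + k] into the one at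
    [n - k]. *)
Lemma spectral_doubling (R : realType) (n : nat) (g1 g2 f : nat -> R) :
  (0 < n)%N -> g1 0%N = 0 -> g2 0%N = 0 ->
  (forall k, (0 < k < n)%N -> g1 k = g1 (n - k)%N) ->
  (forall k, (0 < k < 2 * n)%N -> g2 k = g2 (2 * n - k)%N) ->
  (forall k, (0 < k)%N -> (2 * k < n)%N -> g1 k <= g2 k) ->
  (forall k, (2 * k < n)%N -> g2 k + 1 <= g2 (n - k)%N) ->
  (~~ odd n -> forall x ra rb : R, 0 <= x -> 0 <= ra <= 1 -> 0 <= rb <= 1 ->
    0 <= (2 * (g2 n./2 - g1 n./2) - 1) * (ra + rb * x ^+ 2)
         + g2 n * (1 - x) ^+ 2 - (1 + x ^+ 2)
         + 2 * x * Num.sqrt ((1 + ra) * (1 + rb))) ->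
  (forall j, (j < 2 * n)%N -> 0 <= f j) ->
  2 * (\sum_(k < n) g1 k * (spectrum n (evens f) k + spectrum n (odds f) k))
    + hellinger (\sum_(k < n) spectrum n (evens f) k)
        (\sum_(k < n) spectrum n (odds f) k)
    <= \sum_(k < 2 * n) g2 k * spectrum (2 * n) f k.
Proof.
move=> n0 g10 g20 g1s g2s g12 g2n Hc f0.
pose e k := spectrum n (evens f) k; pose o k := spectrum n (odds f) k.
rewrite -/(e _) -/(o _).
have e0 k : 0 <= e k by exact: spectrum_ge0.
have o0 k : 0 <= o k by exact: spectrum_ge0.
pose F k := g2 k * spectrum (2 * n) f k.
pose z k := dft n (evens f) k.
pose w k := expi (pi * k%:R / n%:R) * dft n (odds f) k.
have wE k : sqmod (w k) = o k by rewrite /w sqmodM sqmod_expi mul1r.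
have TE k : F k + F (n + k)%N =
    g2 k * sqmod (z k + w k) + g2 (n + k)%N * sqmod (z k - w k).
  by rewrite /F /spectrum dft_split// dft_split_half.
have g2r k : (k < n)%N -> g2 (n + k)%N = g2 (n - k)%N.
  by move=> kn; rewrite g2s; [congr g2; lia|lia].
have generic k : (0 < k < n)%N -> (2 * k)%N != n ->
    2 * (g1 k * (e k + o k)) + hellinger (e k) (o k) <= F k + F (n + k)%N.
  move=> /andP[k0 kn] kh; rewrite TE g2r// -wE mulrA.
  have [lt|ge] := ltnP (2 * k) n; first by apply: weighted_pair; auto.
  have gt : (2 * (n - k) < n)%N by lia.
  (* Above [n / 2] the heavier weight of the pair is the one at [k], so [w] is
     replaced by [- w]. *)
  have := @weighted_pair R (g1 (n - k)%N) (g2 (n - k)%N) (g2 k) (z k) (- w k).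
  rewrite opprK sqmodN -(g1s k) ?k0// (addrC (g2 (n - k)%N * _)).
  apply; first by rewrite g1s ?k0//; apply: g12 => //; lia.
  by have := g2n _ gt; rewrite subKn// ltnW.
have zero : g2 n * hellinger (e 0%N) (o 0%N) <= F 0%N + F (n + 0)%N.
  rewrite TE g20 mul0r add0r addn0 -wE ler_wpM2l ?hellinger_sqmod//.
  by have := g2n 0%N; rewrite muln0 subn0 g20 add0r => /(_ n0); lra.
rewrite (sum_halves n F) mulr_sumr.
have [nodd|neven] := boolP (odd n).
  apply: (@le_trans _ _ (\sum_(k < n)
      (2 * (g1 k * (e k + o k)) + hellinger (e k) (o k)))).
    by rewrite [leRHS]big_split lerD2l; apply: hellinger_sum.
  apply: ler_sum => k _; have [->|k0] := posnP k; last first.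
    apply: generic; first by rewrite k0 ltn_ord.
    by apply: contraTneq nodd => <-; rewrite mul2n odd_double.
  rewrite g10 mul0r mulr0 add0r; apply: le_trans zero.
  rewrite ler_peMl ?sqr_ge0//.
  by have := g2n 0%N; rewrite muln0 subn0 g20 add0r => /(_ n0).
have nh : (n./2 < n)%N by lia.
have nE : (2 * n./2)%N = n by lia.
pose i0 := Ordinal n0; pose ih := Ordinal nh.
have h0 : ih != i0 by rewrite -val_eqE/=; lia.
have split (H : nat -> R) : \sum_(k < n) H k =
    H 0%N + H n./2 + \sum_(k < n | (k != i0) && (k != ih)) H k.
  by rewrite (bigD1 i0)//= (bigD1 ih)//= addrA.
rewrite (split (fun k => 2 * (g1 k * (e k + o k)))) (split e) (split o).
rewrite (split (fun k => F k + F (n + k)%N)).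
have half : F n./2 + F (n + n./2)%N = 2 * g2 n./2 * (e n./2 + o n./2).
  rewrite TE g2r// (_ : (n - n./2)%N = n./2); last by lia.
  by rewrite -mulrDr parallelogram wE mulrCA mulrA.
have rest : \sum_(k < n | (k != i0) && (k != ih)) 2 * (g1 k * (e k + o k))
    + hellinger (\sum_(k < n | (k != i0) && (k != ih)) e k)
           (\sum_(k < n | (k != i0) && (k != ih)) o k)
    <= \sum_(k < n | (k != i0) && (k != ih)) (F k + F (n + k)%N).
  apply: (@le_trans _ _ (\sum_(k < n | (k != i0) && (k != ih))
      (2 * (g1 k * (e k + o k)) + hellinger (e k) (o k)))).
    by rewrite [leRHS]big_split lerD2l; apply: hellinger_sum.
  apply: ler_sum => k /andP[]; rewrite -!val_eqE/= => k0 kh.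
  by apply: generic; [rewrite lt0n k0 ltn_ord|rewrite -[n in _ != n]nE; lia].
have fe0 j : (j < n)%N -> 0 <= f (2 * j)%N by move=> jn; apply: f0; lia.
have fo0 j : (j < n)%N -> 0 <= f (2 * j).+1 by move=> jn; apply: f0; lia.
have eh : 0 <= e n./2 <= e 0%N by rewrite e0 spectrum_le0.
have oh : 0 <= o n./2 <= o 0%N by rewrite o0 spectrum_le0.
have real_modes := real_modes_bound (Hc neven) eh oh.
have E0 : 0 <= \sum_(k < n | (k != i0) && (k != ih)) e k by apply: sumr_ge0.
have O0 : 0 <= \sum_(k < n | (k != i0) && (k != ih)) o k by apply: sumr_ge0.
have := hellinger_add (addr_ge0 (e0 0%N) (e0 n./2))
  (addr_ge0 (o0 0%N) (o0 n./2)) E0 O0.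
rewrite half g10; lra.
Qed.

Lemma log_sobolev_double (R : realType) (n : nat) (g1 g2 : nat -> R) :
  (0 < n)%N -> g1 0%N = 0 -> g2 0%N = 0 ->
  (forall k, (0 < k < n)%N -> g1 k = g1 (n - k)%N) ->
  (forall k, (0 < k < 2 * n)%N -> g2 k = g2 (2 * n - k)%N) ->
  (forall k, (0 < k)%N -> (2 * k < n)%N -> g1 k <= g2 k) ->
  (forall k, (2 * k < n)%N -> g2 k + 1 <= g2 (n - k)%N) ->
  (~~ odd n -> forall x ra rb : R, 0 <= x -> 0 <= ra <= 1 -> 0 <= rb <= 1 ->
    0 <= (2 * (g2 n./2 - g1 n./2) - 1) * (ra + rb * x ^+ 2)
         + g2 n * (1 - x) ^+ 2 - (1 + x ^+ 2)
         + 2 * x * Num.sqrt ((1 + ra) * (1 + rb))) ->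
  log_sobolev n g1 -> log_sobolev (2 * n) g2.
Proof.
move=> n0 g10 g20 g1s g2s g12 g2n Hc /(log_sobolevP g1 n0) L.
have n20 : (0 < 2 * n)%N by rewrite muln_gt0.
apply/(log_sobolevP g2 n20) => f f0.
have := spectral_doubling n0 g10 g20 g1s g2s g12 g2n Hc f0.
rewrite ent_split//=.
set fe := evens f; set fo := odds f.
have fe0 k : (k < n)%N -> 0 <= fe k by move=> kn; apply: f0; lia.
have fo0 k : (k < n)%N -> 0 <= fo k by move=> kn; apply: f0; lia.
have Le := L _ fe0; have Lo := L _ fo0.
rewrite -!parseval//.
set E := \sum_(k < n) spectrum n fe k; set O := \sum_(k < n) spectrum n fo k.
have E0 : 0 <= E by apply: sumr_ge0 => k _; exact: spectrum_ge0.
have O0 : 0 <= O by apply: sumr_ge0 => k _; exact: spectrum_ge0.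
set t := n%:R ^+ 2; have t0 : 0 < t by rewrite exprn_gt0// ltr0n.
have := two_point_lsi (divr_ge0 E0 (ltW t0)) (divr_ge0 O0 (ltW t0)).
rewrite -/t in Le Lo; move: Le Lo.
rewrite ![_ / t]mulrC hellingerZ; last by rewrite invr_ge0 ltW.
have -> : \sum_(k < n) g1 k * (spectrum n fe k + spectrum n fo k) =
    \sum_(k < n) g1 k * spectrum n fe k + \sum_(k < n) g1 k * spectrum n fo k.
  by rewrite -big_split; apply: eq_bigr => k _; rewrite mulrDr.
set X := \sum_(k < n) _; set Y := \sum_(k < n) _; set S := \sum_(k < 2 * n) _.
have -> : 2 * (S / (2 * n)%:R ^+ 2) = t^-1 * S / 2.
  by rewrite natrM exprMn -/t; field; exact: lt0r_neq0.
have := t0; rewrite -invr_gt0; move: (t^-1) => r r0 T Le Lo K.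
have {K} := ler_wpM2l (ltW r0) K; lra.
Qed.

(** * The chain of word lengths *)

Lemma log_sobolev_le (R : realType) (n : nat) (g h : nat -> R) : (0 < n)%N ->
  (forall k, (k < n)%N -> g k <= h k) -> log_sobolev n g -> log_sobolev n h.
Proof.
move=> n0 gh /(log_sobolevP g n0) L; apply/(log_sobolevP h n0) => f f0.
apply: le_trans (L f f0) _; rewrite ler_pM2l// ler_wpM2r ?invr_ge0 ?sqr_ge0//.
by apply: ler_sum => k _; rewrite ler_wpM2r ?spectrum_ge0 ?gh.
Qed.

(** The reduction by 1/2 at [N / 2] makes the gain in weight from [Z_N] to
    [Z_(2N)] at that frequency equal to 1/2, which cancels the term with factor
    [2 * (g2 n./2 - g1 n./2) - 1] in the doubling condition. *)
Definition dented_length (R : realType) (N k : nat) : R :=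
  word_length R N k - (if (2 * k == N)%N then 2^-1 else 0).

(** For even [n] the doubling condition reduces to
    [(n - 1/2) * (1 - x) ^ 2 - (1 + x ^ 2) + 2 * x * s >= 0] with [s >= 1]; it
    holds because [n - 1/2 >= 1].  The hypotheses on [g] cover both the word
    length for odd [n], which starts the chain, and the dented length for even
    [n], which continues it. *)
Lemma dented_double (R : realType) (n : nat) (g : nat -> R) : (3 <= n)%N ->
  (forall k, (k < n)%N -> (2 * k)%N != n -> g k = word_length R n k) ->
  (~~ odd n -> g n./2 = word_length R n n./2 - 2^-1) ->
  log_sobolev n g -> log_sobolev (2 * n) (dented_length R (2 * n)).
Proof.
move=> n3 gE gh; have n0 : (0 < n)%N by lia.
have dentE k : (k < n)%N -> dented_length R (2 * n) k = k%:R.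
  move=> kn; rewrite /dented_length /word_length eqn_mul2l/= ltn_eqF// subr0.
  by congr (_%:R); lia.
have dentn : dented_length R (2 * n) n = n%:R - 2^-1.
  by rewrite /dented_length /word_length eqxx; congr (_%:R - _); lia.
have gs k : (2 * k < n)%N -> g k = k%:R.
  by move=> kn; rewrite gE; [congr (_%:R); lia|lia|lia].
apply: log_sobolev_double => //.
- by rewrite gs ?muln0.
- by rewrite dentE.
- move=> k /andP[k0 kn]; have [kh|kh] := eqVneq (2 * k)%N n.
    by congr g; lia.
  by rewrite !gE; [congr (_%:R); lia|lia|lia|lia|lia].
- move=> k /andP[k0 kn]; congr (_%:R - _); first lia.
  by congr (if _ then _ else _); lia.
- by move=> k k0 kn; rewrite gs// dentE//; lia.
- move=> k kn; rewrite [leLHS](_ : _ = k.+1%:R); last first.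
    by rewrite dentE ?natr1//; lia.
  case: k kn => [_|k kn]; last by rewrite dentE ?ler_nat; lia.
  rewrite subn0 dentn; have : (3%:R : R) <= n%:R by rewrite ler_nat.
  lra.
- move=> neven x ra rb x0 /andP[ra0 _] /andP[rb0 _].
  rewrite gh// dentE; last by lia.
  rewrite dentn (_ : word_length R n n./2 = n./2%:R); last first.
    by congr (_%:R); lia.
  have : (3%:R : R) <= n%:R by rewrite ler_nat.
  have : 1 <= Num.sqrt ((1 + ra) * (1 + rb)).
    rewrite -[leLHS]sqrtr1 ler_wsqrtr//; nra.
  move: (Num.sqrt _) (n%:R) (n./2%:R) => s a b s1 a3.
  have := mulr_ge0 x0 (_ : 0 <= s - 1); rewrite subr_ge0 => /(_ s1).
  have := mulr_ge0 (sqr_ge0 (1 - x)) (_ : 0 <= a - 2^-1 - 1).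
  have -> : 0 <= a - 2^-1 - 1 by lra.
  move=> /(_ isT); lra.
Qed.

Lemma dented_chain (R : realType) (n : nat) (m : nat) :
  (3 <= n)%N -> odd n -> log_sobolev n (word_length R n) ->
  log_sobolev (n * 2 ^ m.+1) (dented_length R (n * 2 ^ m.+1)).
Proof.
move=> n3 nodd L; elim: m => [|m IH].
  rewrite expn1 mulnC; apply: dented_double L => //.
  by rewrite nodd.
rewrite expnS mulnCA; apply: dented_double IH => [|k _ kh|even].
- by rewrite (leq_trans n3)// leq_pmulr// expn_gt0.
- by rewrite /dented_length (negPf kh) subr0.
- rewrite /dented_length; case: eqP => // -[]; rewrite mul2n.
  by have := odd_double_half (n * 2 ^ m.+1); rewrite (negPf even).
Qed.

Lemma word_length_chain (R : realType) (n : nat) (m : nat) :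
  (3 <= n)%N -> odd n -> log_sobolev n (word_length R n) -> (1 <= m)%N ->
  log_sobolev (n * 2 ^ m) (word_length R (n * 2 ^ m)).
Proof.
case: m => // m n3 nodd L _.
refine (log_sobolev_le _ _ (dented_chain n3 nodd L)).
  by rewrite muln_gt0 expn_gt0 andbT; lia.
move=> k _; rewrite /dented_length lerBlDr lerDl.
by case: ifP => // _; rewrite invr_ge0.
Qed.

Theorem theorem4p2 (R : realType) :
  (forall (n : nat) (g1 g2 : nat -> R),
     (3 <= n)%N ->
     weight n g1 ->
     weight (2 * n) g2 ->
     g1 0%N = 0 ->
     g2 0%N = 0 ->
     (forall k : nat, (1 <= k <= n - 1)%N -> g1 k = g1 (n - k)%N) ->
     (forall k : nat, (1 <= k <= 2 * n - 1)%N -> g2 k = g2 (2 * n - k)%N) ->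
     (forall k : nat, (1 <= k <= (n - 1) %/ 2)%N -> g1 k <= g2 k) ->
     (forall k : nat, (k <= (n - 1) %/ 2)%N -> 0 <= g2 (n - k)%N - g2 k - 1) ->
     (forall x ra rb : R, 0 <= x -> 0 <= ra <= 1 -> 0 <= rb <= 1 ->
        (~~ odd n ->
           0 <= (2 * g2 (n %/ 2)%N - 2 * g1 (n %/ 2)%N - 1) * (ra + rb * x ^+ 2)
                + g2 n * (1 - x) ^+ 2 - (1 + x ^+ 2)
                + 2 * x * Num.sqrt ((1 + ra) * (1 + rb))) /\
        (odd n ->
           0 <= g2 n * (1 - x) ^+ 2 - (1 + x ^+ 2) + 2 * x)) ->
     log_sobolev n g1 ->
     log_sobolev (2 * n) g2)
  /\
  (forall n0 : nat, (3 <= n0)%N -> odd n0 ->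
     log_sobolev n0 (word_length R n0) ->
     forall m : nat, (1 <= m)%N ->
       log_sobolev (n0 * 2 ^ m) (word_length R (n0 * 2 ^ m))).
Proof.
split; last by move=> n0 n3 nodd L m; exact: word_length_chain.
move=> n g1 g2 n3 _ _ g10 g20 g1s g2s g12 g2n Hc.
apply: log_sobolev_double => //.
- by lia.
- by move=> k kn; apply: g1s; lia.
- by move=> k kn; apply: g2s; lia.
- by move=> k k0 kn; apply: g12; lia.
- move=> k kn; have : 0 <= g2 (n - k)%N - g2 k - 1 by apply: g2n; lia.
  by lra.
- move=> neven x ra rb x0 ra1 rb1.
  have [/(_ neven) H _] := Hc x ra rb x0 ra1 rb1.
  by rewrite mulrBr -divn2.
Qed.
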